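(* Let $n=2k\ge 4$ be an even number. Let $H_n=\{P\oplus P: P\in \mathrm{Sym}(k)\}$, and let $K_n$ be the group of matrices of the form $$\begin{bmatrix} I_k-D & D\\ D & I_k-D\end{bmatrix}$$ such that $D$ is a $k\times k$ diagonal $0$-$1$ matrix with even trace. Then $$G_n=H_nK_n=\{hk: h\in H_n,\ k\in K_n\}$$ is an independent subgroup of the alternating group (that is, $G_n$ is a subgroup of $\mathrm{Alt}(n)$ and is an independent set of $G(\Omega_n)$), with $|G_n|=k!\,2^{k-1}$.
   Context: Elements of the symmetric group $\mathrm{Sym}(m)$ are identified with $m\times m$ permutation matrices: $\sigma$ corresponds to the matrix $P$ with $P_{ij}=1$ if $j=\sigma(i)$ and $P_{ij}=0$ otherwise. $P\oplus P$ is the $2k\times 2k$ block diagonal matrix with both diagonal blocks equal to $P$. The Birkhoff polytope graph $G(\Omega_n)$ has vertex set $\mathrm{Sym}(n)$, and $\sigma_1,\sigma_2$ are adjacent iff $\sigma_1^{-1}\sigma_2$ is a single cycle of length $>1$ (exactly one nontrivial cycle in its disjoint cycle decomposition). An independent set is a set of pairwise nonadjacent vertices; an independent subgroup is a subgroup of $\mathrm{Sym}(n)$ that is an independent set of $G(\Omega_n)$. *)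

(* Defs.v *)
From HB Require Import structures.
From mathcomp Require Import all_boot all_order all_algebra all_fingroup all_solvable.

Set Implicit Arguments.
Unset Strict Implicit.
Unset Printing Implicit Defensive.

Import GRing.Theory.

Local Open Scope ring_scope.

(* A permutation s is identified with perm_mx s, whose (i, j) entry is 1 iff
   s i = j; MathComp composes permutations from left to right, so that
   perm_mx (s * t) = perm_mx s *m perm_mx t. *)

Definition nontrivial_cycles (n : nat) (s : 'S_n) : {set {set 'I_n}} :=
  [set c in porbits s | (1 < #|c|)%N].

Definition is_single_cycle (n : nat) (s : 'S_n) : bool :=
  #|nontrivial_cycles s| == 1%N.

Definition birkhoff_adj (n : nat) : rel 'S_n :=
  fun s1 s2 => is_single_cycle (s1^-1 * s2)%g.

Definition independent_set (T : finType) (e : rel T) (A : {set T}) : Prop :=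
  {in A &, forall x y, x != y -> ~~ e x y}.

Definition independent_subgroup (n : nat) (G : {set 'S_n}) : Prop :=
  group_set G /\ independent_set (@birkhoff_adj n) G.

Definition dsum_mx (k : nat) (P : 'M[int]_k) : 'M[int]_(k + k) :=
  block_mx P 0 0 P.

Definition Hset (k : nat) : {set 'S_(k + k)} :=
  [set s | [exists p : 'S_k, perm_mx s == dsum_mx (perm_mx p)]].

(* The diagonal 0-1 matrices are the diag01 d; the entries lie in int so that
   the trace is an honest count of the ones. *)
Definition diag01 (k : nat) (d : 'rV[bool]_k) : 'M[int]_k :=
  diag_mx (map_mx (fun b : bool => (nat_of_bool b)%:Z) d).

Definition swap_mx (k : nat) (D : 'M[int]_k) : 'M[int]_(k + k) :=
  block_mx (1%:M - D) D D (1%:M - D).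

Definition Kset (k : nat) : {set 'S_(k + k)} :=
  [set s | [exists d : 'rV[bool]_k,
     (2 %| \tr (diag01 d))%Z && (perm_mx s == swap_mx (diag01 d))]].

Definition Gset (k : nat) : {set 'S_(k + k)} := (Hset k * Kset k)%g.

(* Main.v *)
Require Import Defs.
From HB Require Import structures.
From mathcomp Require Import all_boot all_order all_algebra all_fingroup all_solvable.

Set Implicit Arguments.
Unset Strict Implicit.
Unset Printing Implicit Defensive.

Import GRing.Theory.

(** Write the 2k points as pairs (i, b), where i < k and the bit b tells which
    of the two copies of i is meant.  The matrices [P 0; 0 P] are the
    permutations (i, b) |-> (p i, b), those of the second factor flip the bit
    above a set d of indices of even size, and so [Gset k] consists of the
    signed permutations (i, b) |-> (p i, b + d (p i)) with d of even size.
    A determinant computation shows that the signature of such a permutation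
    is (-1)^|d| ([odd_signed]).  Hence [Gset k] is the intersection of the
    group of all signed permutations with the alternating group ([GsetP]),
    which makes it a group of even permutations; as (p, d) is determined by the
    permutation ([signed_inj]) and half of the sets d are even, its order is
    k! 2^(k-1).

    For independence, x^-1 y lies in the group whenever x and y do, so it
    suffices that no element s of the group is a single cycle.  Now s commutes
    with the involution t : (i, b) |-> (i, ~~ b).  If s had just one nontrivial
    cycle C, then t would map C to itself, exchanging the points of C in one
    copy with those in the other; so C would have even length, and s would be
    an odd permutation, whereas the group consists of even ones
    ([even_commute_swap_not_single_cycle]). *)

(** * Cycles *)

(** Conjugation by [t] fixes [s], and carries each cycle of [s] to its image
    under [t]. *)
Lemma porbits_imset_commute (T : finType) (s t : {perm T}) (c : {set T}) :
  commute s t -> c \in porbits s -> t @: c \in porbits s.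
Proof.
move=> cst /imsetP[x _ ->]; apply/imsetP; exists (t x) => //.
have tX i : t ((s ^+ i)%g x) = (s ^+ i)%g (t x).
  by rewrite -!permM (commuteX i (commute_sym cst)).
apply/setP=> y; apply/imsetP/porbitP => [[z /porbitP[i ->] ->]|[i ->]].
  by exists i.
by exists ((s ^+ i)%g x); rewrite ?tX // mem_porbit.
Qed.

Lemma porbits_partition (T : finType) (s : {perm T}) :
  partition (porbits s) [set: T].
Proof.
have -> : porbits s = [set orbit 'P <[s]> x | x in [set: T]]%g.
  apply/setP=> c; apply/imsetP/imsetP => -[x _ ->]; exists x;
    by rewrite ?inE ?porbit.unlock.
apply: (@orbit_partition _ _ _ 'P <[s]>%G).
by apply/actsP=> g _ x; rewrite !inE.
Qed.

(** The parity of a permutation is that of the number of points minus the number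
    of cycles; the fixed points cancel out, which leaves #|C| - 1. *)
Lemma odd_single_cycle (n : nat) (s : 'S_n) (C : {set 'I_n}) :
  nontrivial_cycles s = [set C] -> odd_perm s = ~~ odd #|C|.
Proof.
move=> nontrivC.
have /setIdP[porbC _] : C \in nontrivial_cycles s by rewrite nontrivC set11.
have cardT : #|'I_n| = \sum_(c in porbits s) #|c|.
  by rewrite -cardsT; apply/card_partition/porbits_partition.
have card1 c : c \in porbits s :\ C -> #|c| = 1.
  case/setD1P=> cC cs; apply/eqP; rewrite eqn_leq.
  have c_gt0 : 0 < #|c|.
    by case/imsetP: cs => x _ ->; apply/card_gt0P; exists x; rewrite porbit_id.
  rewrite c_gt0 andbT leqNgt; apply: contra cC => c_gt1.
  by rewrite -in_set1 -nontrivC inE cs.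
rewrite /odd_perm cardT (big_setD1 C) //= (eq_bigr (fun=> 1)) ?sum1_card //.
by rewrite (cardsD1 C (porbits s)) porbC oddD /=; case: odd; case: odd.
Qed.

(** A unique nontrivial cycle C of [s] is mapped to itself by [t].  As [t]
    exchanges L with its complement, C meets both in equally many points, so C
    has even length and [s] would be odd. *)
Lemma even_commute_swap_not_single_cycle (n : nat) (s t : 'S_n)
    (L : {set 'I_n}) :
  ~~ odd_perm s -> commute s t -> t @: L = ~: L -> ~~ is_single_cycle s.
Proof.
move=> even_s cst tL; apply/negP=> /cards1P[C nontrivC].
have /setIdP[porbC C_gt1] : C \in nontrivial_cycles s by rewrite nontrivC set11.
have tC : t @: C = C.
  apply/set1P; rewrite -nontrivC inE porbits_imset_commute //.
  by rewrite card_imset //; apply: perm_inj.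
move: even_s; rewrite (odd_single_cycle nontrivC) negbK -(cardsID L C).
have -> : C :\: L = t @: (C :&: L).
  by rewrite imsetI ?tC ?tL ?setDE // => x y _ _; apply: perm_inj.
by rewrite card_imset ?addnn ?odd_double //; apply: perm_inj.
Qed.

(** * Signed permutations *)

Section SignedPermutations.

Variable k : nat.
Implicit Types (p q : 'S_k) (d e : 'rV[bool]_k) (b c : bool) (i j : 'I_k).

Definition copy b i : 'I_(k + k) := if b then rshift k i else lshift k i.

Lemma copy_surj (x : 'I_(k + k)) : exists b i, x = copy b i.
Proof.
case: (split_ordP x) => i ->; [by exists false, i | by exists true, i].
Qed.

Lemma eq_copy b c i j : (copy b i == copy c j) = (b == c) && (i == j).
Proof. by case: b c => [] []; rewrite /copy !eq_shift. Qed.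

Definition signed_fun p d (x : 'I_(k + k)) : 'I_(k + k) :=
  match split x with
  | inl i => copy (d ord0 (p i)) (p i)
  | inr i => copy (~~ d ord0 (p i)) (p i)
  end.

Lemma signed_funE p d b i :
  signed_fun p d (copy b i) = copy (b (+) d ord0 (p i)) (p i).
Proof.
rewrite /signed_fun; case: b => /=.
  by rewrite -[rshift k i]/(unsplit (inr i)) unsplitK.
by rewrite -[lshift k i]/(unsplit (inl i)) unsplitK.
Qed.

Lemma signed_fun_inj p d : injective (signed_fun p d).
Proof.
move=> x y; have [b [i ->]] := copy_surj x; have [c [j ->]] := copy_surj y.
rewrite !signed_funE => /eqP; rewrite eq_copy.
move=> /andP[/eqP bc /eqP/perm_inj ij].
by move: bc; rewrite ij => /addIb->.
Qed.

(** The element of the hyperoctahedral group Z/2 wr S_k that applies [p] to the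
    indices and then flips the bits selected by [d]; [d] is read at the image
    [p i], so that flipping comes second, as in the product H K. *)
Definition signed p d : 'S_(k + k) := perm (@signed_fun_inj p d).

Lemma signedE p d b i :
  signed p d (copy b i) = copy (b (+) d ord0 (p i)) (p i).
Proof. by rewrite permE signed_funE. Qed.

Lemma signed_ext (s t : 'S_(k + k)) :
  (forall b i, s (copy b i) = t (copy b i)) -> s = t.
Proof. by move=> st; apply/permP=> x; have [b [i ->]] := copy_surj x. Qed.

Lemma signed_inj p q d e : signed p d = signed q e -> p = q /\ d = e.
Proof.
move=> /permP pqde.
have pde i : (d ord0 (p i) == e ord0 (q i)) && (p i == q i).
  by move/eqP: (pqde (copy false i)); rewrite !signedE eq_copy !addFb.
have pq : p = q by apply/permP=> i; case/andP: (pde i) => _ /eqP.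
split=> //; apply/rowP=> i; case/andP: (pde (p^-1 i)%g) => /eqP.
by rewrite -pq permKV.
Qed.

Lemma signedM p q d e :
  (signed p d * signed q e)%g
  = signed (p * q) (\row_i (d ord0 (q^-1 i)%g (+) e ord0 i))%R.
Proof.
apply: signed_ext => b i; rewrite permM !signedE permM mxE permK.
by rewrite addbA.
Qed.

Definition no_flip : 'rV[bool]_k := (const_mx false)%R.
Definition all_flip : 'rV[bool]_k := (const_mx true)%R.

Definition nflips d : nat := \sum_i d ord0 i.

Lemma signed1 : signed 1 no_flip = 1%g.
Proof. by apply: signed_ext => b i; rewrite signedE !perm1 mxE addbF. Qed.

(** The decomposition of a wreath product element along H K; the parity, and
    the identification of [Gset k], are obtained one factor at a time. *)
Lemma signed_factor p d :
  signed p d = (signed p no_flip * signed 1 d)%g.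
Proof.
by apply: signed_ext => b i; rewrite permM !signedE perm1 mxE addbF.
Qed.

Lemma commute_all_flip p d : commute (signed p d) (signed 1 all_flip).
Proof.
by apply: signed_ext => b i; rewrite !permM !signedE !perm1 !mxE addbAC.
Qed.

Lemma all_flip_lshift :
  signed 1 all_flip @: [set copy false i | i : 'I_k]
    = ~: [set copy false i | i : 'I_k].
Proof.
apply/setP=> x; rewrite inE -imset_comp.
have [b [i ->]] := copy_surj x.
have inL (f : 'I_k -> 'I_(k + k)) c : f =1 copy c ->
    (copy b i \in [set f j | j : 'I_k]) = (b == c).
  move=> fE; apply/imsetP/eqP => [[j _ /eqP]|->]; last by exists i.
  by rewrite fE eq_copy => /andP[/eqP].
rewrite (inL _ true) ?(inL _ false) //; first by case: (b).
by move=> j; rewrite [LHS](signedE 1 all_flip false j) perm1 mxE.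
Qed.

(** * Block matrices and parity *)

Local Open Scope ring_scope.

Lemma perm_mx_inj (n : nat) : injective (@perm_mx int n).
Proof.
move=> s t /matrixP st; apply/permP=> i; have := st i (s i).
by rewrite !mxE eqxx; case: eqP => // ->.
Qed.

Lemma perm_mx_unflipped p : perm_mx (signed p no_flip) = dsum_mx (perm_mx p).
Proof.
apply/matrixP=> x y; have [b [i ->]] := copy_surj x.
have [c [j ->]] := copy_surj y.
rewrite [LHS]mxE mxE signedE mxE addbF eq_copy.
by case: b c => [] [] /=;
  rewrite ?block_mxEul ?block_mxEur ?block_mxEdl ?block_mxEdr !mxE.
Qed.

Lemma perm_mx_flip d : perm_mx (signed 1 d) = swap_mx (diag01 d).
Proof.
apply/matrixP=> x y; have [b [i ->]] := copy_surj x.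
have [c [j ->]] := copy_surj y.
rewrite [LHS]mxE mxE signedE perm1 eq_copy.
case: b c => [] [] /=;
  rewrite ?block_mxEul ?block_mxEur ?block_mxEdl ?block_mxEdr !mxE;
  by case: (i =P j) => [->|_]; case: (d _ _); rewrite ?andbF ?mulr1n ?mulr0n.
Qed.

Lemma det_swap_mx (D : 'M[int]_k) : \det (swap_mx D) = \det (1%:M - D *+ 2).
Proof.
(* Adding the top block row to the bottom one turns the latter into [1, 1],
   because the blocks 1 - D and D sum to 1; subtracting the right block column
   from the left one then makes the matrix block triangular. *)
have triangM : block_mx 1%:M 0 1%:M 1%:M *m swap_mx D
      *m block_mx 1%:M 0 (- 1%:M) 1%:M
    = block_mx (1%:M - D *+ 2) D 0 1%:M.
  rewrite /swap_mx !mulmx_block !mul1mx !mulmx1 !mul0mx !mulmx0 !mulmxN !mulmx1.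
  by rewrite !addr0 !add0r subrK [D + _]addrC subrK subrr mulr2n opprD addrA.
have := congr1 determinant triangM.
by rewrite !det_mulmx !det_lblock !det_ublock !det1 !mul1r !mulr1.
Qed.

(** The signature is the square of that of [p]. *)
Lemma odd_unflipped p : odd_perm (signed p no_flip) = false.
Proof.
apply: (@Num.Theory.signr_inj int).
by rewrite -det_perm perm_mx_unflipped det_lblock det_perm -expr2 sqrr_sign.
Qed.

(** By [det_swap_mx] the signature is the determinant of 1 - 2D, a diagonal
    matrix with entries (-1)^(d i). *)
Lemma odd_flip d : odd_perm (signed 1 d) = odd (nflips d).
Proof.
apply: (@Num.Theory.signr_inj int).
rewrite -det_perm perm_mx_flip det_swap_mx.
have -> : 1%:M - diag01 d *+ 2 = diag_mx (\row_i (-1) ^+ d ord0 i).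
  apply/matrixP=> i j; rewrite !mxE; case: (i =P j) => [->|_]; last first.
    by rewrite !mulr0n subr0.
  by rewrite !mulr1n; case: (d _ _).
by rewrite det_diag signr_odd -prodrXr; apply: eq_bigr => i _; rewrite mxE.
Qed.

Lemma odd_signed p d : odd_perm (signed p d) = odd (nflips d).
Proof. by rewrite signed_factor odd_permM odd_unflipped odd_flip. Qed.

Lemma even_trace d :
  (2 %| \tr (diag01 d))%Z = ~~ odd (nflips d).
Proof.
have -> : \tr (diag01 d) = nflips d.
  rewrite /nflips -natz natr_sum; apply: eq_bigr => i _.
  by rewrite !mxE eqxx mulr1n natz.
by rewrite dvdzE /= dvdn2.
Qed.

(** * The group *)

Lemma HsetP (s : 'S_(k + k)) :
  reflect (exists p, s = signed p no_flip) (s \in Hset k).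
Proof.
rewrite inE; apply: (iffP existsP) => [] [p].
  by rewrite -perm_mx_unflipped => /eqP/perm_mx_inj ->; exists p.
by move->; exists p; rewrite perm_mx_unflipped.
Qed.

Lemma KsetP (s : 'S_(k + k)) :
  reflect (exists2 d : 'rV[bool]_k, ~~ odd (nflips d) & s = signed 1 d)
    (s \in Kset k).
Proof.
rewrite inE; apply: (iffP existsP) => [] [d].
  rewrite even_trace -perm_mx_flip => /andP[ev /eqP/perm_mx_inj->].
  by exists d.
by move=> ev ->; exists d; rewrite even_trace ev perm_mx_flip eqxx.
Qed.

(** Evenness of the flip vector is evenness of the permutation, by
    [odd_signed].  In this form closure under products needs no bookkeeping of
    flip vectors, since parity is multiplicative. *)
Lemma GsetP (s : 'S_(k + k)) :
  reflect (exists p d, ~~ odd_perm s /\ s = signed p d) (s \in Gset k).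
Proof.
apply: (iffP mulsgP) => [[_ _ /HsetP[p ->] /KsetP[d ev ->] ->]|[p [d [ev sE]]]].
  by exists p, d; rewrite -signed_factor odd_signed.
exists (signed p no_flip) (signed 1 d).
- by apply/HsetP; exists p.
- by apply/KsetP; exists d => //; rewrite -(odd_signed p) -sE.
- by rewrite sE signed_factor.
Qed.

Lemma group_set_Gset : group_set (Gset k).
Proof.
apply/group_setP; split=> [|s t /GsetP[p [d [evs sE]]] /GsetP[q [e [evt tE]]]].
  by apply/GsetP; exists 1%g, no_flip; rewrite odd_perm1 signed1.
apply/GsetP; rewrite odd_permM (negPf evs) (negPf evt) sE tE signedM.
by do 2 eexists.
Qed.

(** Flipping one fixed coordinate exchanges even and odd vectors; such a
    coordinate exists only if k is positive. *)
Lemma card_even_rows : (0 < k)%N ->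
  #|[set d : 'rV[bool]_k | ~~ odd (nflips d)]| = (2 ^ (k - 1))%N.
Proof.
move=> k_gt0; pose i0 := Ordinal k_gt0; set E := [set d | _].
pose flip d : 'rV[bool]_k := \row_i (d ord0 i (+) (i == i0)).
have flipK : involutive flip.
  by move=> d; apply/rowP=> i; rewrite !mxE -addbA addbb addbF.
have flipE : flip @: E = ~: E.
  have odd_flipped d : odd (nflips (flip d)) = ~~ odd (nflips d).
    rewrite /nflips (bigD1 i0) // [in RHS](bigD1 i0) //= !oddD mxE eqxx addbT.
    rewrite (eq_bigr (fun i => d ord0 i : nat)) => [|i /negPf ne].
      by case: (d _ _); rewrite /= ?negbK.
    by rewrite mxE ne addbF.
  apply/setP=> d; rewrite !inE negbK -[d in LHS]flipK mem_imset ?inE.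
    by rewrite odd_flipped negbK.
  exact: inv_inj.
have /eqP : (#|E| + #|E| = 2 ^ k)%N.
  rewrite -{2}(card_imset (mem E) (inv_inj flipK)) flipE cardsC.
  by rewrite card_mx card_bool mul1n.
have -> : (2 ^ k = (2 ^ (k - 1)).*2)%N by rewrite -mul2n -expnS subn1 prednK.
by rewrite addnn -!muln2 eqn_pmul2r // => /eqP.
Qed.

Lemma card_Gset : (0 < k)%N -> #|Gset k| = (k`! * 2 ^ (k - 1))%N.
Proof.
move=> k_gt0; set E := [set d : 'rV[bool]_k | ~~ odd (nflips d)].
have -> : Gset k = [set signed u.1 u.2 | u in setX [set: 'S_k] E].
  apply/setP=> s; apply/GsetP/imsetP => [[p [d [ev sE]]]|[[p d]]].
    by exists (p, d) => //; rewrite !inE -(odd_signed p) -sE.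
  by rewrite !inE => ev ->; exists p, d; rewrite odd_signed.
rewrite card_imset => [|[p d] [q e] /signed_inj[/= -> ->] //].
by rewrite cardsX cardsT card_Sn card_even_rows.
Qed.

Lemma independent_Gset : independent_set (@birkhoff_adj (k + k)) (Gset k).
Proof.
move=> s t Gs Gt _.
have /GsetP[p [d [even_st stE]]] : (s^-1 * t)%g \in Gset k.
  by rewrite -[Gset k]/(gval (Group group_set_Gset)) groupM ?groupV.
apply: even_commute_swap_not_single_cycle all_flip_lshift => //.
by rewrite stE; apply: commute_all_flip.
Qed.

End SignedPermutations.

Theorem theorem3p3 (k : nat) (hk : (4 <= k + k)%N) :
  [/\ independent_subgroup (Gset k),
      Gset k \subset ('Alt_('I_(k + k)))%g &
      #|Gset k| = (k`! * 2 ^ (k - 1))%N].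
Proof.
split; first by split; [apply: group_set_Gset | apply: independent_Gset].
- by apply/subsetP=> s /GsetP[p [d [even_s _]]]; rewrite Alt_even.
- by apply: card_Gset; case: k hk.
Qed.
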